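(* Let $D$ be a finite set with $m+1$ elements ($m\ge1$), $n\ge1$, $k\ge0$, $\epsilon\ge0$, $0\le\delta\le1$. Suppose the discrete exponential mechanism $\{X_{\mathbf{d}}\mid\mathbf{d}\in D^n\}$ with utility $u(\mathbf{d},\mathbf{d}')=-k\,h(\mathbf{d},\mathbf{d}')$ is $(\epsilon,\delta)$-differentially private. Then its error $\mathcal{E}=\max_{\mathbf{d}\in D^n}\mathbb{E}[h(X_{\mathbf{d}},\mathbf{d})]$ satisfies $$\frac{1-\delta}{1+\frac{e^{\epsilon}}{m}}\le\frac{\mathcal{E}}{n}\le\frac{m}{m+1}.$$
   Context: The discrete exponential mechanism with utility $u$ is the family of $D^n$-valued random variables $X_{\mathbf{d}}$ with $\mathbb{P}(X_{\mathbf{d}}=\mathbf{d}')=C_{\mathbf{d}}^{-1}e^{u(\mathbf{d},\mathbf{d}')}$, $C_{\mathbf{d}}=\sum_{\mathbf{d}'\in D^n}e^{u(\mathbf{d},\mathbf{d}')}$. $h$ is the Hamming distance; $\mathbf{d}\sim\mathbf{d}'$ means $h(\mathbf{d},\mathbf{d}')=1$. $(\epsilon,\delta)$-differential privacy means $\mathbb{P}(X_{\mathbf{d}}\in A)\le e^{\epsilon}\mathbb{P}(X_{\mathbf{d}'}\in A)+\delta$ for all $\mathbf{d}\sim\mathbf{d}'$ (both orders) and all $A\subseteq D^n$. *)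

(* Defs.v *)
From HB Require Import structures.
From mathcomp Require Import all_boot all_order all_algebra.
From mathcomp Require Import all_classical all_reals all_analysis.

Set Implicit Arguments.
Unset Strict Implicit.
Unset Printing Implicit Defensive.

Import Order.TTheory GRing.Theory Num.Theory.

Local Open Scope classical_set_scope.
Local Open Scope ring_scope.

Definition hamming (D : finType) (n : nat) (x y : n.-tuple D) : nat :=
  #|[set i : 'I_n | tnth x i != tnth y i]%SET|.

(* Measurability for the discrete sigma-algebra on a finite type S. The type
   {RV P >-> S} would require S to be a measurableType, hence to come with a
   distinguished point. *)
Definition discrete_rv (dsp : measure_display) (T : measurableType dsp)
    (S : finType) (X : T -> S) : Prop :=
  forall A : set S, measurable (X @^-1` A).

Section mechanisms.
Variables (R : realType) (D : finType) (n : nat).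
Variables (dsp : measure_display) (T : measurableType dsp).
Variable P : probability T R.

Definition exponential_mechanism (u : n.-tuple D -> n.-tuple D -> R)
    (X : n.-tuple D -> T -> n.-tuple D) : Prop :=
  (forall d, discrete_rv (X d)) /\
  (forall d d', P [set w | X d w = d'] =
     ((\sum_(x : n.-tuple D) expR (u d x))^-1 * expR (u d d'))%:E).

Definition differentially_private (epsilon delta : R)
    (X : n.-tuple D -> T -> n.-tuple D) : Prop :=
  forall d d', hamming d d' = 1%N -> forall A : set (n.-tuple D),
    (P (X d @^-1` A) <= (expR epsilon)%:E * P (X d' @^-1` A) + delta%:E)%E.

Definition mechanism_error (X : n.-tuple D -> T -> n.-tuple D) : \bar R :=
  \big[maxe/-oo%E]_(d : n.-tuple D)
    ('E_P[fun w => (hamming (X d w) d)%:R])%E.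

End mechanisms.

(* Main.v *)
Require Import Defs.
From HB Require Import structures.
From mathcomp Require Import all_boot all_order all_algebra.
From mathcomp Require Import all_classical all_reals all_analysis.
From mathcomp Require Import perm measurable_realfun ring lra.

Import Order.TTheory GRing.Theory Num.Theory.

Local Open Scope classical_set_scope.
Local Open Scope ring_scope.

(** Put [q = exp (- k)]. Moving one coordinate of the output away from the true
    value multiplies its weight by [q], so each coordinate of the output is the
    true one with probability [1 / (1 + m q)] and any given other one with
    probability [q / (1 + m q)]. Hence [E / n = p] with [p = m q / (1 + m q)],
    which is at most [m / (m + 1)] because [q <= 1]. Applying privacy to the
    event that one coordinate equals the true one gives
    [1 - p <= exp epsilon * (p / m) + delta], which is the lower bound. *)

Section hamming_weights.
Context {D : finType} {n : nat}.
Implicit Types (d x y : n.-tuple D) (i : 'I_n) (a : D) (s : {perm D}).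

Lemma hammingE x y : hamming x y = (\sum_i (tnth x i != tnth y i))%N.
Proof.
rewrite /hamming -sum1_card big_mkcond; apply: eq_bigr => i _.
by rewrite inE; case: (_ != _).
Qed.

(** Acting on coordinate [i] by a permutation of [D], rather than overwriting it, keeps the map
    injective, so sums over all tuples can be reindexed along it. *)
Definition perm_coord i s x : n.-tuple D :=
  [tuple if j == i then s (tnth x j) else tnth x j | j < n].

Lemma perm_coord_inj i s : injective (perm_coord i s).
Proof.
move=> x y exy; apply: eq_from_tnth => j.
move/(congr1 (fun z => tnth z j)): exy.
by rewrite !tnth_mktuple; case: eqP => // _ /perm_inj.
Qed.

Lemma hamming_perm_coord i s d x :
  tnth x i = tnth d i -> s (tnth d i) != tnth d i ->
  hamming d (perm_coord i s x) = (hamming d x).+1.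
Proof.
move=> xi si; rewrite !hammingE (bigD1 i)//= [in RHS](bigD1 i)//=.
rewrite tnth_mktuple eqxx xi eqxx eq_sym si add1n add0n; congr S.
by apply: eq_bigr => j /negPf ji; rewrite tnth_mktuple ji.
Qed.

Lemma hamming_perm_coord_self i s d :
  s (tnth d i) != tnth d i -> hamming d (perm_coord i s d) = 1.
Proof.
move=> si; rewrite hamming_perm_coord// hammingE big1// => j _.
by rewrite eqxx.
Qed.

Context {R : realFieldType}.
Variable q : R.

(** The transposition of [tnth d i] and [a], applied at coordinate [i], carries the slice of tuples
    agreeing with [d] there onto the slice with value [a], and raises each distance to [d] by
    exactly one. *)
Lemma sum_hamming_coord_neq d i a : a != tnth d i ->
  \sum_(x | tnth x i == a) q ^+ hamming d x =
  q * \sum_(x | tnth x i == tnth d i) q ^+ hamming d x.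
Proof.
move=> ad; rewrite (reindex_inj (@perm_coord_inj i (tperm (tnth d i) a))) /=.
rewrite mulr_sumr; apply: eq_big => [x|x].
  rewrite tnth_mktuple eqxx -(inj_eq (@perm_inj _ (tperm (tnth d i) a))).
  by rewrite tpermK tpermR.
rewrite tnth_mktuple eqxx => /eqP xi.
have {}xi : tnth x i = tnth d i.
  by rewrite -[LHS](tpermK (tnth d i) a) xi tpermR.
by rewrite hamming_perm_coord ?exprS// tpermL.
Qed.

Lemma sum_hamming_coord d i a :
  \sum_(x | tnth x i == a) q ^+ hamming d x =
  (if a == tnth d i then 1 else q) *
    \sum_(x | tnth x i == tnth d i) q ^+ hamming d x.
Proof. by case: eqVneq => [->|/sum_hamming_coord_neq//]; rewrite mul1r. Qed.

(** Slicing by the value of coordinate [i] gives the slice of [d] once and [m] further slices, each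
    scaled by [q]. *)
Lemma sum_hamming m d i : #|D| = m.+1 ->
  \sum_x q ^+ hamming d x =
  (1 + m%:R * q) * \sum_(x | tnth x i == tnth d i) q ^+ hamming d x.
Proof.
move=> cD; rewrite (partition_big (fun x => tnth x i) xpredT)//=.
under eq_bigr do rewrite sum_hamming_coord.
rewrite -mulr_suml; congr (_ * _).
rewrite (bigD1 (tnth d i))//= eqxx; congr (_ + _).
under eq_bigr => a /negPf -> do [].
by rewrite sumr_const cardC1 cD mulr_natl.
Qed.

(** The slice sum of [d] divides both the numerator and the normalising constant. It cancels, being
    positive thanks to its term at [d]. *)
Lemma hamming_coord_marginal m d i a : #|D| = m.+1 -> 0 < q ->
  \sum_(x | tnth x i == a)
    (\sum_y q ^+ hamming d y)^-1 * q ^+ hamming d x =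
  (if a == tnth d i then 1 else q) / (1 + m%:R * q).
Proof.
move=> cD q0; rewrite -mulr_sumr sum_hamming_coord (sum_hamming m d i cD).
set S := \sum_(x | _) _.
have S0 : S != 0.
  rewrite gt_eqF// /S (bigD1 d)//= ltr_wpDr ?exprn_gt0//.
  by apply: sumr_ge0 => x _; rewrite exprn_ge0// ltW.
have q1 : 1 + m%:R * q != 0.
  by rewrite gt_eqF// ltr_pwDl// mulr_ge0// ltW.
by rewrite invfM mulrC -!mulrA; congr (_ * _); rewrite mulrCA mulfV ?mulr1.
Qed.

End hamming_weights.

Section exponential_mechanism_marginals.
Context {R : realType} {dsp : measure_display} {T : measurableType dsp}.
Variable P : probability T R.

Lemma probability_discrete_rv (S : finType) (X : T -> S) (B : {pred S}) :
  discrete_rv X ->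
  P (X @^-1` [set` B]) = (\sum_(x in B) P [set w | X w = x])%E.
Proof.
move=> mX; have -> : X @^-1` [set` B] =
    \bigcup_(x in [set` enum B]) [set w | X w = x].
  apply/seteqP; split => [w /= Bw|w [x /=]].
    by exists (X w) => //=; rewrite mem_enum.
  by rewrite mem_enum => Bx ->.
rewrite measure_fin_bigcup//.
- by rewrite -fsbig_seq ?enum_uniq// big_enum.
- by move=> x y _ _ [w [/= <- <-]].
- by move=> x _; exact: (mX [set x]).
Qed.

(** Linearity of expectation: the distance is the sum over the coordinates of the indicators of
    disagreement. *)
Lemma expectation_hamming (D : finType) (n : nat) (X : T -> n.-tuple D) d :
  discrete_rv X ->
  ('E_P[fun w => (hamming (X w) d)%:R] =
   \sum_(i < n) P (X @^-1` [set x | tnth x i != tnth d i]))%E.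
Proof.
move=> mX; rewrite unlock.
transitivity (\int[P]_w
    (\sum_(i < n) (\1_(X @^-1` [set x | tnth x i != tnth d i]) w)%:E))%E.
  apply: eq_integral => w _; rewrite hammingE natr_sum -sumEFin.
  by apply: eq_bigr => i _; rewrite indicE -[in LHS](asboolb (_ != _)).
rewrite ge0_integral_sum//; last first.
  move=> i; apply/measurable_EFinP; apply: measurable_indic; exact: mX.
apply: eq_bigr => i _; rewrite integral_indic ?setIT//; exact: mX.
Qed.

Context {D : finType} {m n : nat} (k : R) (X : n.-tuple D -> T -> n.-tuple D).
Hypothesis card_D : #|D| = m.+1.
Hypothesis X_exp : exponential_mechanism P
  (fun d d' : n.-tuple D => - k * (hamming d d')%:R) X.
Let q := expR (- k).

Lemma exponential_mechanism_coord d i a :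
  P (X d @^-1` [set x | tnth x i == a]) =
  ((if a == tnth d i then 1 else q) / (1 + m%:R * q))%:E.
Proof.
have [mX PX] := X_exp.
rewrite (@probability_discrete_rv _ _ [pred x | tnth x i == a])//.
rewrite -(hamming_coord_marginal _ m d i a card_D) ?expR_gt0// -sumEFin.
apply: eq_bigr => x _; rewrite PX; under eq_bigr do rewrite expRM_natr.
by rewrite expRM_natr.
Qed.

Lemma exponential_mechanism_expectation d :
  ('E_P[fun w => (hamming (X d w) d)%:R] =
   (n%:R * (m%:R * q / (1 + m%:R * q)))%:E)%E.
Proof.
have [mX _] := X_exp; rewrite expectation_hamming//.
have q1 : 1 + m%:R * q != 0.
  by rewrite gt_eqF// ltr_pwDl// mulr_ge0// expR_ge0.
rewrite (eq_bigr (fun=> (m%:R * q / (1 + m%:R * q))%:E)).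
  by rewrite sumEFin sumr_const card_ord [in RHS]mulr_natl.
move=> i _; set A := [set x | tnth x i == tnth d i].
have -> : X d @^-1` [set x | tnth x i != tnth d i] = ~` (X d @^-1` A).
  by apply/seteqP; split=> w /= /negP.
rewrite probability_setC; last exact: mX.
rewrite exponential_mechanism_coord eqxx -EFinB; congr EFin.
by field.
Qed.

Lemma exponential_mechanism_error :
  mechanism_error P X = (n%:R * (m%:R * q / (1 + m%:R * q)))%:E.
Proof.
rewrite /mechanism_error.
under eq_bigr do rewrite exponential_mechanism_expectation.
(* All the expectations are equal, but a tuple must be exhibited, since a maximum over no tuples
   would be the default [-oo]. *)
have /card_gt0P[a _] : (0 < #|D|)%N by rewrite card_D.
apply/eqP; rewrite eq_le; apply/andP; split.
  by apply: bigmax_le => //; rewrite leNye.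
exact: (le_bigmax _ _ [tuple of nseq n a]).
Qed.

End exponential_mechanism_marginals.

Theorem theorem5 (R : realType) (D : finType) (m n : nat) (k epsilon delta : R)
  (dsp : measure_display) (T : measurableType dsp) (P : probability T R)
  (X : n.-tuple D -> T -> n.-tuple D)
  (card_D : #|D| = m.+1) (m_ge1 : (1 <= m)%N) (n_ge1 : (1 <= n)%N)
  (k_ge0 : 0 <= k) (epsilon_ge0 : 0 <= epsilon)
  (delta_ge0 : 0 <= delta) (delta_le1 : delta <= 1)
  (X_exp : exponential_mechanism P
             (fun d d' : n.-tuple D => - k * (hamming d d')%:R) X)
  (X_dp : differentially_private P epsilon delta X) :
  (((1 - delta) / (1 + expR epsilon / m%:R))%:E
     <= mechanism_error P X / n%:R%:E)%E /\
  (mechanism_error P X / n%:R%:E <= (m%:R / (m.+1)%:R)%:E)%E.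
Proof.
have n0 : n%:R != 0 :> R by rewrite pnatr_eq0 -lt0n.
(* Division by [n] takes place in the extended reals, where it returns to a real quotient only
   because [n] is nonzero. *)
rewrite (exponential_mechanism_error P k X card_D X_exp) inver (negPf n0) -EFinM.
rewrite mulrAC mulfV// mul1r !lee_fin.
have m0 : 0 < m%:R :> R by rewrite ltr0n.
have q0 : 0 < expR (- k) by exact: expR_gt0.
have q1 : expR (- k) <= 1 by rewrite -expR0 ler_expR oppr_le0.
have e0 := expR_gt0 epsilon.
have i0 : 'I_n := Ordinal n_ge1.
have /card_gt1P[a [b [_ _ ab]]] : (1 < #|D|)%N by rewrite card_D.
pose d : n.-tuple D := [tuple of nseq n a].
pose d' := perm_coord i0 (tperm a b) d.
have di : tnth d i0 = a by rewrite tnth_nseq.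
have d'i : tnth d' i0 = b by rewrite tnth_mktuple eqxx di tpermL.
have dd' : hamming d d' = 1%N.
  by rewrite hamming_perm_coord_self// di tpermL eq_sym.
(* The value [a] at [i0] is the true one for [d] and a wrong one for [d'], so privacy reads [1 / (1
   + m q) <= exp epsilon * q / (1 + m q) + delta]. *)
have := X_dp d d' dd' [set x | tnth x i0 == a].
rewrite !(exponential_mechanism_coord P k X card_D X_exp) di d'i eqxx (negPf ab).
rewrite -EFinM -EFinD lee_fin.
move: (expR (- k)) (expR epsilon) q0 q1 e0 => q e q0 q1 e0.
rewrite -[m.+1%:R]natr1; move: (m%:R) m0 => M M0 dp.
have Mq : 0 < M * q by exact: mulr_gt0.
split; last first.
  (* Cross-multiplied, the upper bound reduces to [M * q <= M]. *)
  by rewrite ler_pdivrMr ?addr_gt0// mulrAC ler_pdivlMr ?addr_gt0//; nra.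
have -> : 1 + e / M = (M + e) / M by field; rewrite gt_eqF.
rewrite invf_div mulrA ler_pdivrMr ?addr_gt0//.
rewrite mulrAC ler_pdivlMr ?addr_gt0//.
move: dp; rewrite mulrA -subr_ge0.
have -> : e * q / (1 + M * q) + delta - 1 / (1 + M * q) =
    (e * q + delta * (1 + M * q) - 1) / (1 + M * q).
  by field; rewrite gt_eqF// addr_gt0.
rewrite pmulr_lge0 ?invr_gt0 ?addr_gt0// => dp.
(* With denominators cleared, the two sides of the goal differ by exactly [M] times the quantity
   that [dp] bounds below by 0: the terms [M ^ 2 * q] cancel. *)
have := mulr_ge0 (ltW M0) dp; nra.
Qed.
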